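(* There is a constant $c > 0$ such that, for all integers $m \geq 1$ and $k \geq 2$, the sub-Ramsey number satisfies $$sr(m,k) \leq c\, m k^2 \log k.$$
   Context: Write $[n] = \{1, \ldots, n\}$. A $k$-term arithmetic progression in $[n]$ is a set $\{a, a+d, \ldots, a+(k-1)d\} \subseteq [n]$ with $d \geq 1$ an integer. In a coloring of $[n]$, an arithmetic progression is rainbow if its elements all have different colors. The sub-Ramsey number $sr(m,k)$ is the minimum positive integer $n$ such that every coloring of $[n]$ (with any number of colors) in which no color is used more than $m$ times has a rainbow $k$-term arithmetic progression; the asserted bound includes that such an $n$ exists. Logarithms are to base $e$. *)

(* Defs.v *)
From mathcomp Require Import all_boot.
Set Implicit Arguments.
Unset Strict Implicit.
Unset Printing Implicit Defensive.

(* [n] = {1, ..., n}; note that iota 1 n has n elements and ends at n. *)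
Definition interval1 (n : nat) : seq nat := iota 1 n.

Definition arith_prog (k a d : nat) : seq nat := mkseq (fun i => a + i * d)%N k.

(* Only the values of f on [n] matter: colorings of [n] are represented by
   functions on nat, and C is an arbitrary (possibly infinite) set of colors. *)
Definition color_bounded (C : eqType) (m n : nat) (f : nat -> C) : Prop :=
  forall c : C, (count (fun x => f x == c) (interval1 n) <= m)%N.

Definition rainbow (C : eqType) (f : nat -> C) (A : seq nat) : Prop :=
  {in A &, injective f}.

Definition has_rainbow_ap (C : eqType) (k n : nat) (f : nat -> C) : Prop :=
  exists a d : nat,
    [/\ (1 <= d)%N, {subset arith_prog k a d <= interval1 n} &
        rainbow f (arith_prog k a d)].

Definition forces_rainbow_ap (m k n : nat) : Prop :=
  forall (C : eqType) (f : nat -> C),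
    color_bounded m n f -> has_rainbow_ap k n f.

(* The relation "sr(m,k) exists and equals n". *)
Definition is_sub_ramsey (m k n : nat) : Prop :=
  [/\ (1 <= n)%N, forces_rainbow_ap m k n &
      forall n' : nat, (1 <= n')%N -> forces_rainbow_ap m k n' -> (n <= n')%N].

(* Main.v *)
(** Only progressions whose difference [d] has no prime factor below [k]
    ("[k]-rough") are used. Two terms differ by [j * d] with [0 < j < k], and
    [j * d] determines [d], so a monochromatic pair lies in fewer than [k] such
    progressions. In [n = 2 * k * x] there are at least [k * x * R(x)] of them,
    [R(x)] being the number of [k]-rough [d <= x], and at most [n * m]
    monochromatic pairs, so [R(x) > 2 * m * k] suffices.

    It remains to see [R(x) >= x / (1280 * ln k)] once [x >= 448 * k * ln k + 1].
    Counting prime powers in [\sum ln n] over rough [n <= x], Chebyshev's lower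
    bound gives [R(x) * ln x >= x / 32 * H], with [H] the sum of [1 / m] over rough
    [m] up to about [x / (k * ln k)]. Finally [H] is at least of order
    [ln x / ln k], because every integer is a rough one times a smooth one and the
    reciprocals of the smooth ones sum to at most [20 * ln k]. *)
Require Import Defs.
From HB Require Import structures.
From mathcomp Require Import all_boot all_order all_algebra.
From mathcomp Require Import all_classical all_reals all_analysis.
From mathcomp Require Import zify ring lra.
Import Order.TTheory GRing.Theory Num.Theory.

(** * Rough numbers and the count of progressions against monochromatic pairs *)

Definition below (k : nat) : nat_pred := [pred p | (p < k)%N].

Lemma belowP (k p : nat) : (p \in below k) = (p < k).
Proof. by []. Qed.

Lemma below_nat_lt (k j : nat) : 0 < j -> j < k -> (below k).-nat j.
Proof.
move=> j0 jk; apply/pnatP => // p _ pj.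
by rewrite belowP (leq_ltn_trans (dvdn_leq j0 pj)).
Qed.

(** This is [R(x)]. Being in [(below k)^'.-nat] means having all prime factors at least [k] (rough);
    [(below k).-nat] is the smooth counterpart. Zero is in neither. *)
Definition rough_count (k x : nat) : nat := count (below k)^'.-nat (iota 1 x).

(* The difference of two terms is [j * d] with [0 < j < k], and [j] is built
   from primes below [k] while [d] has none: the product determines [d]. *)
Lemma rough_mul_inj (k j j' d d' : nat) :
  0 < j < k -> 0 < j' < k -> (below k)^'.-nat d -> (below k)^'.-nat d' ->
  j * d = j' * d' -> d = d'.
Proof.
move=> /andP[j0 jk] /andP[j0' jk'] rd rd' e.
have c := p'nat_coprime rd (below_nat_lt _ _ j0' jk').
have c' := p'nat_coprime rd' (below_nat_lt _ _ j0 jk).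
apply/eqP; rewrite eqn_dvd; apply/andP; split.
  by rewrite -(Gauss_dvdr _ c) -e dvdn_mull.
by rewrite -(Gauss_dvdr _ c') e dvdn_mull.
Qed.

Lemma not_rainbow_pair (C : eqType) (f : nat -> C) (k a d : nat) :
  ~ rainbow f (arith_prog k a d) ->
  exists ij : nat * nat,
    [/\ ij.1 < ij.2, ij.2 < k & f (a + ij.1 * d) = f (a + ij.2 * d)].
Proof.
move=> nr; apply: contrapT => H; apply: nr => u v.
move=> /mapP[i]; rewrite mem_iota => /andP[_ ik] ->.
move=> /mapP[j]; rewrite mem_iota => /andP[_ jk] -> e.
case: (ltngtP i j) => [ij|ji|-> //].
  by case: H; exists (i, j); split.
by case: H; exists (j, i); split.
Qed.

Lemma rough_forces_rainbow (m k x : nat) :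
  0 < k -> 0 < x -> 2 * m * k < rough_count k x ->
  forces_rainbow_ap m k (2 * k * x).
Proof.
move=> k0 x0 big C f fm; apply: contrapT => nor.
pose n := 2 * k * x.
(* Starts up to [k * x] and differences up to [x] keep every term [a + i * d], [i < k], inside
   [[2 * k * x]]. *)
pose A := [seq (a, d) | a <- iota 1 (k * x),
                        d <- [seq d <- iota 1 x | (below k)^'.-nat d]].
have AP a d : (a, d) \in A ->
    [/\ 0 < a <= k * x, 0 < d <= x & (below k)^'.-nat d].
  case/allpairsP => -[a' d'] /=; rewrite mem_filter !mem_iota.
  by case=> H1 /andP[H2 H3] [-> ->]; split => //; lia.
have /choice[h hP] : forall ad : nat * nat, exists ij : nat * nat,
    ad \in A -> [/\ ij.1 < ij.2, ij.2 < k &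
                    f (ad.1 + ij.1 * ad.2) = f (ad.1 + ij.2 * ad.2)].
  move=> [a d]; have [adA|_] := boolP ((a, d) \in A); last by exists (0, 0).
  have [aP dP _] := AP _ _ adA.
  have [|ij ijP] := @not_rainbow_pair C f k a d; last by exists ij.
  move=> rb; apply: nor; exists a, d; split => //; first by case/andP: dP.
  move=> u /mapP[i]; rewrite !mem_iota => /andP[_ ik] ->.
  have : i * d <= k * x by apply: leq_mul; lia.
  by move: aP; lia.
(* There are at most [n * m] pairs of equal color, even with [u = v] allowed. The pair determines
   only [d]; storing the index [i] of its first point recovers [a] too, at the price of a factor
   [k]. *)
pose B := [seq (uv, i) | uv <- [seq (u, v) | u <- iota 1 n,
             v <- [seq v <- iota 1 n | f v == f u]], i <- iota 0 k].
pose g (ad : nat * nat) := ((ad.1 + (h ad).1 * ad.2, ad.1 + (h ad).2 * ad.2),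
                            (h ad).1).
have uA : uniq A.
  apply: allpairs_uniq; rewrite ?filter_uniq ?iota_uniq //.
  by move=> [? ?] [? ?] _ _ [-> ->].
have g_inj : {in A &, injective g}.
  move=> [a d] [a' d'] adA adA'.
  have [_ _ rd] := AP _ _ adA; have [_ _ rd'] := AP _ _ adA'.
  have [] := hP _ adA; have [] := hP _ adA'.
  rewrite /g /=; case: (h (a, d)) => i j; case: (h (a', d')) => i' j' /=.
  move=> lij' ljk' _ lij ljk _ [e1 e2 ei]; subst i'.
  have e : (j - i) * d = (j' - i) * d' by rewrite !mulnBl; lia.
  have ed : d = d' by apply: (@rough_mul_inj k (j - i) (j' - i)) => //; lia.
  by subst d'; congr (_, _); lia.
have gB : {subset map g A <= B}.
  move=> _ /mapP[[a d] adA ->].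
  have [aP dP _] := AP _ _ adA; have [] := hP _ adA.
  rewrite /g; case: (h (a, d)) => i j /= ij jk e.
  have id : i * d <= k * x by apply: leq_mul; lia.
  have jd : j * d <= k * x by apply: leq_mul; lia.
  apply/allpairsP; exists ((a + i * d, a + j * d), i); split => //=.
    apply/allpairsPdep; exists (a + i * d), (a + j * d).
    rewrite mem_filter e eqxx !mem_iota /n; split => //; lia.
  by rewrite mem_iota; lia.
have := uniq_leq_size _ gB; rewrite map_inj_in_uniq // => /(_ uA).
rewrite size_map !size_allpairs !size_iota size_filter -/(rough_count k x).
rewrite size_allpairs_dep.
have : sumn [seq size [seq v <- iota 1 n | f v == f u] | u <- iota 1 n]
       <= n * m.
  have : forall s, sumn [seq size [seq v <- iota 1 n | f v == f u] | u <- s]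
       <= size s * m; last by move/(_ (iota 1 n)); rewrite size_iota.
  elim=> //= u s IH.
  by rewrite mulSn leq_add // size_filter; apply: fm.
move=> le1 le2; have := leq_trans le2 (leq_mul le1 (leqnn k)).
rewrite /n.
have : k * x * (2 * m * k) < k * x * rough_count k x.
  by rewrite ltn_pmul2l // muln_gt0 k0.
have -> : 2 * k * x * m * k = k * x * (2 * m * k) by lia.
lia.
Qed.

(** Well-ordering; forcing quantifies over all colorings, so it is made boolean classically. *)
Lemma is_sub_ramsey_le (m k n : nat) :
  0 < n -> forces_rainbow_ap m k n -> exists2 n', is_sub_ramsey m k n' & n' <= n.
Proof.
move=> n0 fn.
have ex : exists i, (0 < i) && `[< forces_rainbow_ap m k i >].
  by exists n; rewrite n0; apply/asboolP.
case: (ex_minnP ex) => n' /andP[n'0 /asboolP fn'] min; exists n'.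
  by split => // i i0 fi; apply: min; rewrite i0; apply/asboolP.
by apply: min; rewrite n0; apply/asboolP.
Qed.

(** * Prime powers in the central binomial coefficient *)

Lemma trunc_log_count (p y N : nat) : 1 < p -> y <= N ->
  trunc_log p y = \sum_(1 <= a < N.+1) (p ^ a <= y).
Proof.
move=> p1 yN; have [->|y0] := posnP y.
  rewrite trunc_log0 big1 // => a _; rewrite leqn0 expn_eq0; lia.
transitivity (\sum_(1 <= a < N.+1) (a <= trunc_log p y)).
  have tN : trunc_log p y <= N.
    apply: leq_trans yN; apply: ltnW; apply: leq_trans (trunc_logP p1 y0).
    exact: ltn_expl.
  rewrite (@big_cat_nat _ _ _ (trunc_log p y).+1) //=.
  rewrite [X in _ + X]big1_seq ?addn0; last first.
    by move=> a; rewrite mem_index_iota; lia.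
  rewrite (eq_big_nat _ _ (F2 := fun=> 1)) ?sum_nat_const_nat ?muln1 ?subn1 //.
  by move=> a /andP[_]; rewrite ltnS => ->.
apply: eq_bigr => a _; congr nat_of_bool; apply/idP/idP => [at_|pa].
  by apply: leq_trans (trunc_logP p1 y0); rewrite leq_exp2l.
exact: trunc_log_max.
Qed.

(** By Legendre's formula the exponent is the sum over [a] of [2n %/ p^a - 2 (n %/ p^a)]; each term
    is 0 or 1, and it vanishes once [p^a > 2n]. *)
Lemma logn_bin_le (p n : nat) : prime p ->
  logn p 'C(n.*2, n) <= trunc_log p n.*2.
Proof.
move=> pp; have p1 := prime_gt1 pp.
have nn : n <= n.*2 by lia.
have := bin_fact nn; have -> : n.*2 - n = n by lia.
move/(congr1 (logn p)); rewrite !lognM ?muln_gt0 ?bin_gt0 ?fact_gt0 //.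
rewrite !logn_fact //.
have -> : \sum_(1 <= k < n.+1) n %/ p ^ k = \sum_(1 <= k < n.*2.+1) n %/ p ^ k.
  rewrite [RHS](@big_cat_nat _ _ _ n.+1) //=.
  rewrite [X in _ = _ + X]big1_seq ?addn0 // => a /andP[_].
  rewrite mem_index_iota => /andP[na _]; apply: divn_small.
  by apply: leq_trans na _; apply: ltnW; exact: ltn_expl.
move=> e; rewrite -(@leq_add2r (\sum_(1 <= k < n.*2.+1) n %/ p ^ k +
  \sum_(1 <= k < n.*2.+1) n %/ p ^ k)) e.
rewrite (trunc_log_count _ _ _ p1 (leqnn _)) -!big_split /=.
apply: leq_sum => a _; set q := p ^ a.
have q0 : 0 < q by rewrite expn_gt0; lia.
have [qn|qn] := leqP q n.*2; last by rewrite divn_small.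
rewrite -ltnS ltn_divLR //.
have := divn_eq n q; have := ltn_pmod n q0; nia.
Qed.

(** * Comparing sums along injections, and prime powers dividing rough numbers *)

Lemma ler_sum_sub (R : numDomainType) (I : eqType) (r s : seq I) (F : I -> R) :
  uniq r -> {subset r <= s} -> (forall i, 0 <= F i)%R ->
  (\sum_(i <- r) F i <= \sum_(i <- s) F i)%R.
Proof.
move=> ur rs F0; elim: r s ur rs => [s _ _|i r IH s /= /andP[ir ur] rs].
  by rewrite big_nil sumr_ge0.
have si : i \in s by rewrite rs ?mem_head.
rewrite big_cons (perm_big _ (perm_to_rem si)) big_cons lerD2l IH // => j jr.
have := rs j; rewrite inE jr orbT => /(_ isT).
rewrite (perm_mem (perm_to_rem si)) inE => /orP[/eqP ji|//].
by rewrite -ji jr in ir.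
Qed.

(** Serves every later reindexing: multiplying by a prime power, dividing by a prime, splitting into
    smooth and rough parts, or (with [g] the identity) enlarging the range. *)
Lemma ler_sum_inj (R : numDomainType) (I J : eqType) (r : seq I) (s : seq J)
    (P : pred I) (Q : pred J) (F : I -> R) (G : J -> R) (g : I -> J) :
  uniq r -> {in [pred i | (i \in r) && P i] &, injective g} ->
  (forall j, 0 <= G j)%R ->
  (forall i, i \in r -> P i -> [/\ g i \in s, Q (g i) & F i <= G (g i)]%R) ->
  (\sum_(i <- r | P i) F i <= \sum_(j <- s | Q j) G j)%R.
Proof.
move=> ur ginj G0 H.
rewrite big_seq_cond; apply: (@le_trans _ _ (\sum_(i <- r | P i) G (g i))%R).
  rewrite [leRHS]big_seq_cond; apply: ler_sum => i /andP[ir Pi].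
  by have [] := H i ir Pi.
rewrite -big_filter -(big_map g xpredT) -[leRHS]big_filter.
apply: ler_sum_sub => //.
  rewrite map_inj_in_uniq ?filter_uniq // => i j.
  by rewrite !mem_filter => /andP[Pi ir] /andP[Pj jr]; apply: ginj; apply/andP.
move=> _ /mapP[i + ->]; rewrite !mem_filter => /andP[Pi ir].
by have [? -> _] := H i ir Pi.
Qed.

(** The left side counts pairs [(a, m)] with [p^a * m <= x], the right side pairs [(a, n)] with
    [p^a] dividing [n]. As [p >= k], the map [m] to [p^a * m] preserves roughness. *)
Lemma sum_trunc_log_rough (k p x : nat) : k <= p -> prime p ->
  \sum_(1 <= m < x.+1 | (below k)^'.-nat m) trunc_log p (x %/ m)
  <= \sum_(1 <= n < x.+1 | (below k)^'.-nat n) logn p n.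
Proof.
move=> kp pp; have p1 := prime_gt1 pp.
under eq_bigr do rewrite (trunc_log_count p _ x p1 (leq_div _ _)).
rewrite exchange_big /=.
apply: (@leq_trans (\sum_(1 <= a < x.+1)
          \sum_(1 <= n < x.+1 | (below k)^'.-nat n) (p ^ a %| n))); last first.
  rewrite exchange_big /= big_seq_cond [leqRHS]big_seq_cond.
  apply: leq_sum => n /andP[]; rewrite mem_index_iota => /andP[n0 nx] _.
  rewrite logn_count_dvd // (@big_cat_nat _ _ _ n) ?(ltnW nx) //=.
  rewrite [X in _ + X]big1_seq ?addn0 // => a /andP[_].
  rewrite mem_index_iota => /andP[na _]; rewrite gtnNdvd //.
  by apply: leq_ltn_trans na _; exact: ltn_expl.
apply: leq_sum => a _.
rewrite -(ler_nat int) !natr_sum.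
have q0 : 0 < p ^ a by rewrite expn_gt0; lia.
have rq : (below k)^'.-nat (p ^ a) by rewrite pnatX pnatE // inE /= -leqNgt kp.
under eq_bigr do rewrite mulrb.
under [X in (_ <= X)%R]eq_bigr do rewrite mulrb.
rewrite -!big_mkcondr /=.
apply: (@ler_sum_inj _ _ _ _ _ _ _ _ _ (fun m => p ^ a * m)).
- exact: iota_uniq.
- by move=> u v _ _ /eqP; rewrite eqn_pmul2l // => /eqP.
- by [].
move=> u; rewrite mem_index_iota => /andP[u0 ux] /andP[ru le].
have le' : p ^ a * u <= x by rewrite -leq_divRL.
split; rewrite ?mem_index_iota ?muln_gt0 ?q0 ?u0 //.
by rewrite pnatM rq ru dvdn_mulr.
Qed.

(** * Logarithms of integers and harmonic sums *)

Definition recip_sum (R : realType) (pi : nat_pred) (N : nat) : R :=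
  (\sum_(1 <= n < N.+1 | pi.-nat n) n%:R^-1)%R.

Local Open Scope ring_scope.

Lemma ln_logn (R : realType) (n M : nat) : (0 < n)%N ->
  (forall p, prime p -> (p %| n)%N -> (p < M)%N) ->
  ln n%:R = \sum_(0 <= p < M) (logn p n)%:R * ln p%:R :> R.
Proof.
move=> n0 nM; pose L := maxn M n.+1.
have -> : \sum_(0 <= p < M) (logn p n)%:R * ln p%:R
        = \sum_(0 <= p < L) (logn p n)%:R * ln p%:R :> R.
  rewrite [RHS](@big_cat_nat _ _ _ M) ?leq_maxl //=.
  rewrite [X in _ = _ + X]big1_seq ?addr0 // => p /andP[_].
  rewrite mem_index_iota => /andP[Mp _].
  suff -> : logn p n = 0%N by rewrite mul0r.
  apply/eqP; rewrite -leqn0 leqNgt logn_gt0 mem_primes n0 /=.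
  by apply/negP => /andP[pp pn]; have := nM _ pp pn; lia.
have L0 : (0 < L)%N by rewrite /L; lia.
have nL : (n <= L.-1)%N by rewrite /L; lia.
rewrite -{1}(partnT n0) (widen_partn _ nL) prednK //.
(* Positivity of the partial products is carried along because [lnM] requires it. *)
pose K (y : nat) (z : R) := (0 < y)%N /\ ln y%:R = z.
suff [] : K (\prod_(0 <= p < L | p \in predT) p ^ logn p n)%N
  (\sum_(0 <= p < L) (logn p n)%:R * ln p%:R) by [].
apply: (big_rec2 K) => [|p y z _ [y0 <-]]; first by split; rewrite ?ln1.
have p0 : (0 < p ^ logn p n)%N.
  by case: p => [|p]; rewrite ?expn_gt0 // lognE.
split; first by rewrite muln_gt0 p0.
rewrite natrM lnM ?posrE ?ltr0n //; congr (_ + _).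
case: p p0 => [|p] p0; first by rewrite lognE /= mul0r ln1.
by rewrite natrX lnXn ?ltr0n // mulr_natl.
Qed.

Lemma ln_nat_ge0 (R : realType) (n : nat) : 0 <= ln n%:R :> R.
Proof. by case: n => [|n]; [rewrite ln0 | rewrite ln_ge0 // ler1n]. Qed.

Lemma ler_ln_nat (R : realType) (m n : nat) : (0 < m)%N -> (m <= n)%N ->
  ln m%:R <= ln n%:R :> R.
Proof.
by move=> m0 mn; rewrite ler_ln ?posrE ?ltr0n ?ler_nat //; apply: leq_trans mn.
Qed.

Lemma ln_succ_le (R : realType) (n : nat) : (0 < n)%N ->
  ln n.+1%:R <= ln n%:R + n%:R^-1 :> R.
Proof.
move=> n0; have n0' : 0 < n%:R :> R by rewrite ltr0n.
have i0 : 0 < n%:R^-1 :> R by rewrite invr_gt0.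
have -> : n.+1%:R = n%:R * (1 + n%:R^-1) :> R.
  by rewrite -natr1 mulrDr mulr1 divff // gt_eqF.
rewrite lnM ?posrE ?addr_gt0 // lerD2l le_ln1Dx //; lra.
Qed.

Lemma ln_succ_ge (R : realType) (n : nat) : (0 < n)%N ->
  ln n%:R + n.+1%:R^-1 <= ln n.+1%:R :> R.
Proof.
move=> n0; have n0' : 0 < n%:R :> R by rewrite ltr0n.
have n1 : 0 < n.+1%:R :> R by rewrite ltr0n.
have i1 : 0 < n.+1%:R^-1 :> R by rewrite invr_gt0.
have i2 : n.+1%:R^-1 < 1 :> R by rewrite invf_lt1 ?ltr1n.
have -> : n%:R = n.+1%:R * (1 - n.+1%:R^-1) :> R.
  by rewrite mulrBr mulr1 divff ?gt_eqF // -natr1; ring.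
rewrite lnM ?posrE ?subr_gt0 //.
rewrite -addrA gerDl -lerBrDr sub0r.
by apply: le_ln1Dx; rewrite ltrN2.
Qed.

Lemma harmonic_le (R : realType) (N : nat) :
  \sum_(1 <= n < N.+1) n%:R^-1 <= 1 + ln N%:R :> R.
Proof.
elim: N => [|[|N] IH]; first by rewrite big_geq // ln0 // addr0.
  by rewrite big_nat1 invr1 ln1 addr0.
rewrite big_nat_recr //=; apply: le_trans (lerD IH (lexx _)) _.
by rewrite -addrA lerD2l ln_succ_ge.
Qed.

Lemma harmonic_ge (R : realType) (N : nat) :
  ln N.+1%:R <= \sum_(1 <= n < N.+1) n%:R^-1 :> R.
Proof.
elim: N => [|N IH]; first by rewrite big_geq // ln1.
rewrite big_nat_recr //=; apply: le_trans (ln_succ_le _ _ _) _ => //.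
by rewrite lerD2r.
Qed.

(** * A Mertens-type bound and the reciprocals of smooth and rough numbers *)

Lemma prime_dvd_fact (p k : nat) : prime p -> (p %| k`!)%N -> (p <= k)%N.
Proof.
move=> pp; elim: k => [|k IH]; first by rewrite fact0 dvdn1; case: eqP pp => // ->.
rewrite factS Euclid_dvdM // => /orP[/dvdn_leq -> //|/IH]; exact: leqW.
Qed.

Lemma ln_fact_le (R : realType) (k : nat) : ln k`!%:R <= k%:R * ln k%:R :> R.
Proof.
elim: k => [|k IH]; first by rewrite fact0 ln1 mul0r.
rewrite factS natrM lnM ?posrE ?ltr0n ?fact_gt0 // -natr1 mulrDl mul1r addrC.
rewrite lerD2r (le_trans IH) //; case: k {IH} => [|k]; first by rewrite !mul0r.
by rewrite ler_wpM2l // natr1 ler_ln_nat.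
Qed.

(** Mertens' argument: compare [ln k! <= k * ln k] with the factorization of [k!], in which [p] has
    exponent at least [k %/ p]. *)
Lemma sum_ln_prime_le (R : realType) (k : nat) :
  \sum_(0 <= p < k | prime p) ln p%:R / (p%:R - 1) <= 4 * ln k%:R :> R.
Proof.
have [->|k0] := posnP k; first by rewrite big_geq // ln0 // mulr0.
have k0' : 0 < k%:R :> R by rewrite ltr0n.
rewrite -(ler_pM2l k0') mulrCA -ler_pdivrMl //.
apply: le_trans (ln_fact_le R k).
rewrite (@ln_logn _ _ k.+1) ?fact_gt0 //; last first.
  by move=> p pp; exact: prime_dvd_fact.
rewrite big_nat_recr //= !mulr_sumr.
apply: (@le_trans _ _ (\sum_(0 <= p < k) (logn p k`!)%:R * ln p%:R)); last first.
  by rewrite lerDl mulr_ge0 ?ln_nat_ge0.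
rewrite big_mkcond /= big_seq [leRHS]big_seq; apply: ler_sum => p.
rewrite mem_index_iota => /andP[_ pk].
case: ifP => pp; last by rewrite mulr_ge0 ?ln_nat_ge0.
have p1 := prime_gt1 pp; have p1' : 0 < p%:R - 1 :> R by rewrite subr_gt0 ltr1n.
rewrite !mulrA (mulrAC _ (ln _)) ler_wpM2r ?ln_nat_ge0 //.
rewrite ler_pdivrMr // ler_pdivrMl //.
(* With [q = k %/ p >= 1]: [k < (q + 1) * p <= 2 * q * p <= 4 * q * (p - 1)]. *)
have : (k <= 4 * (logn p k`! * p.-1))%N.
  have : (k %/ p <= logn p k`!)%N.
    by rewrite logn_fact // big_nat_recl // expn1 leq_addr.
  have : (0 < k %/ p)%N by rewrite divn_gt0; lia.
  have := divn_eq k p; have := @ltn_pmod k p; nia.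
rewrite -(ler_nat R) !natrM -subn1 natrB ?prime_gt0 //.
Qed.

Lemma sum_logn_smooth_le (R : realType) (pi : nat_pred) (p N : nat) : prime p ->
  \sum_(1 <= s < N.+1 | pi.-nat s) (logn p s)%:R / s%:R
  <= recip_sum R pi N / (p%:R - 1).
Proof.
move=> pp; have p1 := prime_gt1 pp.
have p1' : 0 < p%:R - 1 :> R by rewrite subr_gt0 ltr1n.
have p0' : 0 < p%:R :> R by rewrite ltr0n; lia.
set V := \sum_(_ <= _ < _ | _) _; set H := recip_sum _ _ _.
(* Only multiples [s = p * t] contribute, and there [logn p s = 1 + logn p t]; the bound on [V] thus
   refers back to [V]. *)
suff : V <= (H + V) / p%:R by rewrite ler_pdivlMr // ler_pdivlMr //; lra.
rewrite /V /H /recip_sum -big_split /= mulr_suml.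
rewrite (bigID (fun s => p %| s)%N) /= [X in _ + X]big1 ?addr0; last first.
  by move=> s /andP[_ ps]; rewrite logn_coprime ?mul0r // prime_coprime.
apply: (@ler_sum_inj _ _ _ _ _ _ _ _ _ (fun s => s %/ p)%N).
- exact: iota_uniq.
- move=> s t /andP[_ /andP[_ /divnK ps]] /andP[_ /andP[_ /divnK pt]] e.
  by rewrite -ps e pt.
- by move=> t; rewrite divr_ge0 ?addr_ge0 ?invr_ge0 ?divr_ge0.
move=> s; rewrite mem_index_iota => /andP[s0 sN] /andP[ps /dvdnP[t st]].
subst s; rewrite mulnK; last lia.
move: s0; rewrite muln_gt0 => /andP[t0 _]; move: ps; rewrite pnatM => /andP[-> _].
split => //; first by rewrite mem_index_iota; nia.
rewrite lognM ?(ltnW p1) // (@logn_prime p p) // eqxx natrM natrD.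
rewrite invfM mulrA ler_wpM2r ?invr_ge0 ?(ltW p0') //.
by rewrite mulrDl mul1r addrC.
Qed.

Lemma recip_sum_ge0 (R : realType) (pi : nat_pred) (N : nat) :
  0 <= recip_sum R pi N.
Proof. by apply: sumr_ge0 => n _; rewrite invr_ge0. Qed.

Lemma ln2_ge (R : realType) : 2^-1 <= ln 2 :> R.
Proof.
have : ln (1 - 2^-1) <= - 2^-1 :> R by apply: le_ln1Dx; lra.
have -> : 1 - 2^-1 = 2^-1 :> R by lra.
by rewrite lnV ?posrE //; lra.
Qed.

(** Expand [ln s] over the primes below [k], exchange the sums, and bound each prime's share by
    [sum_logn_smooth_le]. *)
Lemma sum_ln_smooth_le (R : realType) (k N : nat) :
  \sum_(1 <= s < N.+1 | (below k).-nat s) ln s%:R / s%:R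
  <= 4 * ln k%:R * recip_sum R (below k) N.
Proof.
have -> : \sum_(1 <= s < N.+1 | (below k).-nat s) ln s%:R / s%:R
  = \sum_(0 <= p < k) ln p%:R *
      \sum_(1 <= s < N.+1 | (below k).-nat s) (logn p s)%:R / s%:R :> R.
  under [RHS]eq_bigr do rewrite mulr_sumr.
  rewrite [RHS]exchange_big /= big_seq_cond [RHS]big_seq_cond.
  apply: eq_bigr => s /andP[]; rewrite mem_index_iota => /andP[s0 _].
  move=> /pnatP smooth.
  rewrite (@ln_logn _ s k) // ?mulr_suml; last exact: smooth.
  by apply: eq_bigr => p _; rewrite mulrCA mulrA.
apply: (@le_trans _ _ (\sum_(0 <= p < k | prime p)
    ln p%:R / (p%:R - 1) * recip_sum R (below k) N)).
  rewrite [leRHS]big_mkcond /=; apply: ler_sum => p _; case: ifP => pp.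
    rewrite mulrAC -mulrA ler_wpM2l ?ln_nat_ge0 //.
    exact: sum_logn_smooth_le.
  rewrite big1 ?mulr0 // => s _; by rewrite lognE pp mul0r.
by rewrite -mulr_suml ler_wpM2r ?recip_sum_ge0 // sum_ln_prime_le.
Qed.

(* By the previous bound [ln s] has mean at most [4 ln k] for the weights
   [1 / s], so by Markov half of the mass sits on [s <= k ^ 8]. *)
Lemma recip_sum_smooth_le (R : realType) (k N : nat) : (1 < k)%N ->
  recip_sum R (below k) N <= 20 * ln k%:R.
Proof.
move=> k1; have k0 : 0 < k%:R :> R by rewrite ltr0n; lia.
have lk : 2^-1 <= ln k%:R :> R.
  by apply: le_trans (ln2_ge R) _; apply: ler_ln_nat.
have lk0 : 0 < 8 * ln k%:R :> R by lra.
have : recip_sum R (below k) N <= \sum_(1 <= s < (k ^ 8).+1) s%:R^-1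
   + (8 * ln k%:R)^-1 * \sum_(1 <= s < N.+1 | (below k).-nat s) ln s%:R / s%:R.
  rewrite /recip_sum (bigID (fun s => s <= k ^ 8)%N) /= lerD //.
    apply: (@ler_sum_inj _ _ _ _ _ _ _ _ _ id) => //.
    - exact: iota_uniq.
    - by move=> s; rewrite mem_index_iota => /andP[s0 _] /andP[_ sk];
        rewrite mem_index_iota s0 ltnS.
  rewrite mulr_sumr big_mkcondr /=; apply: ler_sum => s _; case: ifP => sk.
    rewrite mulrA -[leLHS]mul1r ler_wpM2r ?invr_ge0 // ler_pdivlMl // mulr1.
    have -> : 8 * ln k%:R = ln (k ^ 8)%:R :> R.
      by rewrite natrX lnXn // mulr_natl.
    by apply: ler_ln_nat; [rewrite expn_gt0; lia | lia].
  by rewrite !mulr_ge0 ?invr_ge0 ?ln_nat_ge0 // ltW.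
have := sum_ln_smooth_le R k N; rewrite -(ler_pM2l (_ : 0 < (8 * ln k%:R)^-1)) ?invr_gt0 //.
have -> : (8 * ln k%:R)^-1 * (4 * ln k%:R * recip_sum R (below k) N)
   = recip_sum R (below k) N / 2.
  by field; lra.
(* With [S] the sum to bound, [S <= 1 + 8 ln k + S / 2], so [S <= 2 + 16 ln k], and
   [2 <= 4 ln k]. *)
have := harmonic_le R (k ^ 8); rewrite natrX lnXn // -[ln _ *+ 8]mulr_natl; lra.
Qed.

(** Each [n <= N] is the product of its [pi]-part and its [pi^']-part, both at most [N], so the
    expanded product contains the harmonic sum. *)
Lemma ln_le_recip_sums (R : realType) (pi : nat_pred) (N : nat) :
  ln N.+1%:R <= recip_sum R pi N * recip_sum R pi^' N.
Proof.
apply: le_trans (harmonic_ge R N) _.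
pose r (rho : nat_pred) := [seq n <- index_iota 1 N.+1 | rho.-nat n].
have -> : recip_sum R pi N * recip_sum R pi^' N =
    \sum_(sm <- [seq (s, m) | s <- r pi, m <- r pi^']) (sm.1 * sm.2)%:R^-1.
  rewrite big_allpairs /recip_sum -[X in X * _]big_filter.
  rewrite -[X in _ * X]big_filter mulr_suml.
  apply: eq_bigr => s _; rewrite mulr_sumr; apply: eq_bigr => m _.
  by rewrite natrM invfM.
apply: (@ler_sum_inj _ _ _ _ _ _ _ _ _ (fun n => (n`_pi, n`_pi^'))%N).
- exact: iota_uniq.
- move=> u v /andP[]; rewrite mem_index_iota => /andP[u0 _] _.
  move=> /andP[]; rewrite mem_index_iota => /andP[v0 _] _ [e1 e2].
  by rewrite -(partnC pi u0) e1 e2 partnC.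
- by move=> sm; rewrite invr_ge0.
move=> n; rewrite mem_index_iota => /andP[n0 nN] _; split => //=.
  by rewrite allpairs_f // mem_filter part_pnat mem_index_iota part_gt0;
    apply: leq_ltn_trans nN; apply: dvdn_leq => //; apply: dvdn_part.
by rewrite partnC.
Qed.

(** * Chebyshev's lower bound for [psi_from], the share of psi(y) due to primes from [k] to [N] *)

Definition psi_from (R : realType) (k N y : nat) : R :=
  \sum_(k <= p < N.+1 | prime p) (trunc_log p y)%:R * ln p%:R.

Lemma psi_from_ge0 (R : realType) (k N y : nat) : 0 <= psi_from R k N y.
Proof. by apply: sumr_ge0 => p _; rewrite mulr_ge0 ?ln_nat_ge0. Qed.

(** Each prime below [k] contributes at most [ln (2n)] to the factorization; the others are counted
    by [psi_from], [N] being large enough to miss none. *)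
Lemma ln_bin_le (R : realType) (k n N : nat) : (0 < n)%N -> (n.*2 <= N)%N ->
  ln 'C(n.*2, n)%:R <= k%:R * ln n.*2%:R + psi_from R k N n.*2 :> R.
Proof.
move=> n0 nN.
have tl p : prime p -> (trunc_log p n.*2)%:R * ln p%:R <= ln n.*2%:R :> R.
  move=> pp; have p0 := prime_gt0 pp.
  rewrite mulr_natl -lnXn ?ltr0n // -natrX ler_ln_nat ?expn_gt0 ?p0 //.
  by apply: trunc_logP; [exact: prime_gt1 | lia].
pose F p : R := if prime p then (trunc_log p n.*2)%:R * ln p%:R else 0.
have F0 p : 0 <= F p by rewrite /F; case: ifP => // _; rewrite mulr_ge0 ?ln_nat_ge0.
have nn : (n <= n.*2)%N by lia.
rewrite (@ln_logn _ _ N.+1) ?bin_gt0 //; last first.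
  move=> p pp pC; apply: leq_trans nN.
  apply: prime_dvd_fact => //.
  by rewrite -(bin_fact nn) dvdn_mulr.
apply: (@le_trans _ _ (\sum_(0 <= p < N.+1) F p)).
  apply: ler_sum => p _; rewrite /F; case: ifP => pp.
    by rewrite ler_wpM2r ?ln_nat_ge0 // ler_nat logn_bin_le.
  by rewrite lognE pp mul0r.
rewrite /psi_from [X in _ + X]big_mkcond /= -/F.
have Fk : forall j, (\sum_(0 <= p < j) F p <= j%:R * ln n.*2%:R).
  move=> j; rewrite mulr_natl -[in leRHS](subn0 j) -sumr_const_nat.
  apply: ler_sum => p _; rewrite /F; case: ifP => [/tl//|_]; exact: ln_nat_ge0.
have [kN|Nk] := leqP k N.+1.
  by rewrite (@big_cat_nat _ _ _ k) //= lerD2r.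
apply: le_trans (Fk _) _; rewrite big_geq ?addr0; last exact: ltnW.
by rewrite ler_wpM2r ?ln_nat_ge0 // ler_nat ltnW.
Qed.

(** Pascal's rule, applied twice, finds two copies of ['C(2n, n)] in ['C(2n + 2, n + 1)]. *)
Lemma expn2_le_bin (n : nat) : (2 ^ n <= 'C(n.*2, n))%N.
Proof.
elim: n => // n IH; rewrite doubleS !binS expnS.
case: n IH => [|n] IH //; rewrite [X in (_ <= X + _)%N]addnC.
rewrite [X in (_ <= _ + X)%N]binS; lia.
Qed.

Lemma psi_from_le (R : realType) (k N y z : nat) : (y <= z)%N ->
  psi_from R k N y <= psi_from R k N z.
Proof.
move=> yz; apply: ler_sum => p _.
by rewrite ler_wpM2r ?ln_nat_ge0 // ler_nat leq_trunc_log.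
Qed.

(** The binomial coefficient at [n = y./2] gives at least [(y - 1) / 4], and the primes below [k]
    cost at most [k * ln y <= y / 64 + 7 * k * ln k <= y / 32], as [448 = 7 * 64]. *)
Lemma psi_from_ge (R : realType) (k N y : nat) : (1 < k)%N -> (y <= N)%N ->
  448 * k%:R * ln k%:R <= y%:R :> R -> y%:R / 16 <= psi_from R k N y.
Proof.
move=> k1 yN ky; have k0 : 2 <= k%:R :> R by rewrite ler_nat.
have l2 := ln2_ge R.
have lk : ln 2 <= ln k%:R :> R by apply: ler_ln_nat.
have y2 : (y <= (y./2 * 2).+1)%N by lia.
have yn : (y./2.*2 <= y)%N by lia.
have y4 : 4 <= y%:R :> R by nra.
have y0 : (0 < y)%N by rewrite -(ltr_nat R); lra.
have n0 : (0 < y./2)%N by move: y4; rewrite ler_nat; lia.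
have H := @ln_bin_le R k _ N n0 (leq_trans yn yN).
have H2 := psi_from_le R k N _ _ yn.
have H3 : ln y./2.*2%:R <= ln y%:R :> R by apply: ler_ln_nat => //; rewrite double_gt0.
have H4 : (y./2)%:R * ln 2 <= ln 'C(y./2.*2, y./2)%:R :> R.
  rewrite mulr_natl -lnXn // -natrX ler_ln_nat ?expn_gt0 //.
  exact: expn2_le_bin.
have H5 : y%:R <= (y./2)%:R * 2 + 1 :> R.
  by rewrite -natrM natr1 ler_nat.
(* Split [y] as [y / (64 k)] times [64 k]; use [ln u <= u] on the first factor and [64 = 2^6 <= k^6]
   on the second. *)
have H6 : ln y%:R <= y%:R / (64 * k%:R) + 7 * ln k%:R :> R.
  have k64 : 0 < 64 * k%:R :> R by lra.
  have -> : y%:R = y%:R / (64 * k%:R) * (64 * k%:R) :> R.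
    by rewrite divfK // gt_eqF.
  rewrite mulfK ?gt_eqF // lnM ?posrE ?divr_gt0 ?ltr0n //.
  apply: lerD; first by apply/ltW/ln_sublinear; rewrite divr_gt0 ?ltr0n.
  rewrite lnM ?posrE //; last lra.
  have -> : 64 = 2 ^+ 6 :> R by rewrite -natrX.
  rewrite lnXn // -[ln 2 *+ 6]mulr_natl; lra.
have H7 : k%:R * ln y%:R <= y%:R / 64 + 7 * (k%:R * ln k%:R) :> R.
  apply: (@le_trans _ _ (k%:R * (y%:R / (64 * k%:R) + 7 * ln k%:R))).
    by rewrite ler_wpM2l.
  suff -> : k%:R * (y%:R / (64 * k%:R) + 7 * ln k%:R) =
    y%:R / 64 + 7 * (k%:R * ln k%:R) :> R by [].
  by field; rewrite gt_eqF //; lra.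
have H8 : k%:R * ln y./2.*2%:R <= k%:R * ln y%:R :> R by rewrite ler_wpM2l.
have H9 : (y./2)%:R * 2^-1 <= (y./2)%:R * ln 2 :> R by rewrite ler_wpM2l.
lra.
Qed.

(** * The lower bound for the number of rough integers *)

Lemma sum_psi_le (R : realType) (k x : nat) :
  \sum_(1 <= m < x.+1 | (below k)^'.-nat m) psi_from R k x (x %/ m)
  <= (rough_count k x)%:R * ln x%:R.
Proof.
have -> : (rough_count k x)%:R * ln x%:R =
    \sum_(1 <= n < x.+1 | (below k)^'.-nat n) ln x%:R :> R.
  by rewrite big_const_seq iter_addr_0 mulr_natl /index_iota subn1.
(* The middle term is at most the sum of [ln n] over rough [n <= x]; the first comparison is made
   prime by prime. *)
apply: (@le_trans _ _ (\sum_(1 <= n < x.+1 | (below k)^'.-nat n)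
    \sum_(k <= p < x.+1 | prime p) (logn p n)%:R * ln p%:R)).
  rewrite exchange_big [X in _ <= X]exchange_big /= big_seq_cond.
  rewrite [X in _ <= X]big_seq_cond; apply: ler_sum => p /andP[].
  rewrite mem_index_iota => /andP[kp _] pp.
  rewrite -!mulr_suml -!natr_sum ler_wpM2r ?ln_nat_ge0 // ler_nat.
  exact: sum_trunc_log_rough.
rewrite big_seq_cond [X in _ <= X]big_seq_cond; apply: ler_sum => n /andP[].
rewrite mem_index_iota => /andP[n0 nx] _.
apply: (@le_trans _ _ (ln n%:R)); last by rewrite ler_ln_nat.
rewrite (@ln_logn _ _ x.+1) //; last first.
  by move=> p _ /(dvdn_leq n0) pn; apply: leq_ltn_trans nx.
apply: (@ler_sum_inj _ _ _ _ _ _ _ _ _ id) => //.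
- exact: iota_uniq.
- by move=> p; rewrite mulr_ge0 ?ln_nat_ge0.
- by move=> p; rewrite !mem_index_iota => /andP[_ ->].
Qed.

Lemma rough_count_ge (R : realType) (k x : nat) : (1 < k)%N ->
  448 * k%:R * ln k%:R + 1 <= x%:R :> R ->
  x%:R / (1280 * ln k%:R) <= (rough_count k x)%:R :> R.
Proof.
move=> k1 kx; have k0 : 2 <= k%:R :> R by rewrite ler_nat.
have lk : 2^-1 <= ln k%:R :> R.
  by apply: le_trans (ln2_ge R) _; apply: ler_ln_nat.
have k1' : ln k%:R <= k%:R :> R by apply/ltW/ln_sublinear; lra.
have t0 : 0 <= 448 * k%:R * ln k%:R :> R by nra.
(* [W] is the integer threshold from which [psi_from_ge] applies; [m <= x %/ W] ensures
   [x %/ m >= W]. *)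
have [W [W0 Wt tW]] : exists W : nat, [/\ (0 < W)%N,
    W%:R <= 448 * k%:R * ln k%:R + 1 :> R & 448 * k%:R * ln k%:R < W%:R :> R].
  have /andP[] := truncn_itv t0; set t := Num.trunc _ => tt tW.
  by exists t.+1; split => //; rewrite -[t.+1%:R]natr1 lerD2r.
have W0' : 0 < W%:R :> R by rewrite ltr0n.
have Wx : (W <= x)%N by rewrite -(ler_nat R); lra.
have lW : ln W%:R <= 11 * ln k%:R :> R.
  have W512 : W%:R <= 512 * k%:R ^+ 2 :> R by rewrite expr2; nra.
  have pos512 : 0 < 512 * k%:R ^+ 2 :> R by apply: lt_le_trans W512.
  have : ln W%:R <= ln (512 * k%:R ^+ 2) :> R by rewrite ler_ln ?posrE.
  move/le_trans; apply.
  have l2 : ln 2 <= ln k%:R :> R by apply: ler_ln_nat.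
  have k0' : 0 < k%:R :> R by lra.
  have -> : 512 = 2 ^+ 9 :> R by rewrite -natrX.
  rewrite lnM ?posrE ?exprn_gt0 // !lnXn //.
  rewrite -[ln 2 *+ 9]mulr_natl -[ln _ *+ 2]mulr_natl; lra.
pose M := (x %/ W)%N; pose H := recip_sum R (below k)^' M.
have M0 : (0 < M)%N by rewrite divn_gt0.
have H1 : 1 <= H.
  by rewrite /H /recip_sum big_ltn_cond //= invr1 lerDl sumr_ge0.
have x0 : (0 < x)%N by apply: leq_trans Wx.
have xM : ln x%:R <= ln M.+1%:R + ln W%:R :> R.
  by rewrite -lnM ?posrE ?ltr0n // -natrM ler_ln_nat // ltnW // ltn_ceil.
have HM := ln_le_recip_sums R (below k) M.
have HS := recip_sum_smooth_le R k M k1.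
(* If [ln x <= 2 ln W], then [22 ln k] and [H >= 1] suffice. Otherwise [ln (M + 1) >= ln x / 2],
   while [ln (M + 1) <= 20 * ln k * H]. *)
have lx : ln x%:R <= 40 * ln k%:R * H.
  have [le|lt] := leP (ln x%:R) (2 * ln W%:R : R); first by nra.
  have : recip_sum R (below k) M * H <= 20 * ln k%:R * H.
    by rewrite ler_wpM2r // (le_trans _ H1).
  rewrite -/H in HM; move: (ln M.+1%:R) xM HM => v xM HM; lra.
have := sum_psi_le R k x.
have : x%:R / 32 * H <= \sum_(1 <= m < x.+1 | (below k)^'.-nat m)
    psi_from R k x (x %/ m).
  rewrite /H /recip_sum mulr_sumr.
  apply: (@ler_sum_inj _ _ _ _ _ _ _ _ _ id) => //.
  - exact: iota_uniq.
  - by move=> m; rewrite psi_from_ge0.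
  move=> m; rewrite !mem_index_iota ltnS => /andP[m0 mM] rm.
  have mWx : (m * W <= x)%N by rewrite -leq_divRL.
  have Wxm : (W <= x %/ m)%N by rewrite leq_divRL // mulnC.
  split => //; first by rewrite m0 ltnS (leq_trans mM) // leq_div.
  apply: le_trans (psi_from_ge _ _ _ _ k1 (leq_div _ _) _); last first.
    by apply: le_trans (ltW tW) _; rewrite ler_nat.
  rewrite ler_pdivrMr ?ltr0n //.
  (* Rounding [x / m] down loses at most a factor 2, turning 1/16 into 1/32; later
     [1280 = 32 * 40]. *)
  have : (x <= 2 * ((x %/ m) * m))%N.
    have := ltn_ceil x m0; have : (m <= x %/ m * m)%N.
      by rewrite leq_pmull // (leq_trans _ Wxm).
    by rewrite mulSn; move: (x %/ m * m)%N => u; clear; lia.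
  rewrite -(ler_nat R) !natrM; lra.
move=> A1 A2; have A3 : (rough_count k x)%:R * ln x%:R <=
    (rough_count k x)%:R * (40 * ln k%:R * H) by rewrite ler_wpM2l.
have lk0 : 0 < 1280 * ln k%:R :> R by lra.
rewrite ler_pdivrMr // -(ler_pM2r (_ : 0 < H)); last by apply: lt_le_trans H1.
lra.
Qed.

(** * Choice of [x] and the final constant *)

Theorem corollary3 (R : realType) :
  exists c : R, 0 < c /\
    forall m k : nat, (1 <= m)%N -> (2 <= k)%N ->
      exists n : nat, is_sub_ramsey m k n /\
        n%:R <= c * m%:R * k%:R ^+ 2 * ln k%:R.
Proof.
exists 5124; split; first by rewrite ltr0n.
move=> m k m1 k2.
have k0 : 2 <= k%:R :> R by rewrite ler_nat.
have m0 : 1 <= m%:R :> R by rewrite ler1n.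
have lk : 2^-1 <= ln k%:R :> R.
  by apply: le_trans (ln2_ge R) _; apply: ler_ln_nat.
(* [2 * m * k * (1280 * ln k) = 2560 * y], so any [x > 2560 * y] has [R(x) > 2 * m * k]; [x = t + 1]
   is the first such integer. *)
pose y : R := m%:R * (k%:R * ln k%:R).
have kl1 : 1 <= k%:R * ln k%:R :> R by nra.
have ky : k%:R * ln k%:R <= y by rewrite /y ler_peMl //; lra.
have y0 : 0 <= 2560 * y by lra.
have /andP[] := truncn_itv y0; set t := Num.trunc _ => ty yt.
have yx : 448 * k%:R * ln k%:R + 1 <= t.+1%:R :> R.
  by apply: le_trans (ltW yt); lra.
have big : (2 * m * k < rough_count k t.+1)%N.
  rewrite -(ltr_nat R); apply: lt_le_trans (rough_count_ge R k t.+1 k2 yx).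
  rewrite ltr_pdivlMr; last lra.
  by apply: le_lt_trans yt; rewrite !natrM /y; lra.
have k_gt0 : (0 < k)%N by apply: ltnW.
have n_gt0 : (0 < 2 * k * t.+1)%N by rewrite !muln_gt0 k_gt0.
have [n sn le] := is_sub_ramsey_le m k _ n_gt0
  (rough_forces_rainbow m k t.+1 k_gt0 isT big).
exists n; split => //.
(* As [y >= 1], [t + 1 <= 2560 * y + 1 <= 2562 * y], and [5124 = 2 * 2562]. *)
apply: (@le_trans _ _ (2 * k * t.+1)%:R); first by rewrite ler_nat.
have -> : 5124 * m%:R * k%:R ^+ 2 * ln k%:R = 2 * k%:R * (2562 * y).
  by rewrite /y; ring.
rewrite !natrM -[t.+1%:R]natr1; apply: ler_wpM2l; lra.
Qed.
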